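(* There is no regular graph of degree $d\ge3$ with $d\equiv 0$ or $2\pmod 3$, girth $7$, and cyclic excess.
   Context: For an integer $d\ge 1$ define polynomials $G_{d,m}(x)$ by $G_{d,0}(x)=1$, $G_{d,1}(x)=x+1$, and $G_{d,m+1}(x)=xG_{d,m}(x)-(d-1)G_{d,m-1}(x)$ for $m\ge1$. Let $J_n$ be the $n\times n$ all-ones matrix. For a graph on $n\ge3$ vertices, a cycle matrix is the adjacency matrix $B$ of an $n$-cycle on the same vertex set (i.e., for some ordering $v_1,\dots,v_n$ of the vertices, $B_{ij}=1$ iff $v_i,v_j$ are cyclically consecutive, and $0$ otherwise); this cycle need not consist of edges of the graph. A graph $\Gamma$ of order $n$ with adjacency matrix $A$ is a graph of degree $d$, girth $g$ and cyclic excess if $\Gamma$ is $d$-regular with $d\ge3$, has odd girth $g\ge5$, and $G_{d,\lfloor g/2\rfloor}(A)=J_n-B$ for some cycle matrix $B$. *)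

(* Defs.v *)
From mathcomp Require Import all_boot all_order all_algebra all_fingroup.

Set Implicit Arguments.
Unset Strict Implicit.
Unset Printing Implicit Defensive.

Import GRing.Theory.
Local Open Scope ring_scope.

Fixpoint G (d m : nat) : {poly int} :=
  match m with
  | 0 => 1
  | (m'.+1 as m1).+1 => 'X * G d m1 - (d%:R - 1) *: G d m'
  | 1 => 'X + 1
  end.

Definition regular (T : finType) (e : rel T) (d : nat) : Prop :=
  forall x : T, #|[pred y | e x y]| = d.

(* The size condition is needed because [ucycle] accepts the empty sequence
   and, for a symmetric relation, closed walks of length 2 along an edge. *)
Definition graph_cycle (T : finType) (e : rel T) (c : seq T) : Prop :=
  (3 <= size c)%N /\ ucycle e c.

Definition has_girth (T : finType) (e : rel T) (g : nat) : Prop :=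
  (exists2 c : seq T, graph_cycle e c & size c = g) /\
  (forall c : seq T, graph_cycle e c -> (g <= size c)%N).

Definition adj_mx (T : finType) (e : rel T) (n : nat) (v : 'I_n -> T) :
    'M[int]_n :=
  \matrix_(i, j) (e (v i) (v j))%:R.

(* [s 0, s 1, ..., s (n - 1)] is the cyclic ordering of the indices. *)
Definition cycle_mx (n : nat) (B : 'M[int]_n) : Prop :=
  (3 <= n)%N /\
  exists s : 'S_n, forall i j : 'I_n,
    B (s i) (s j) = ((j == ordS i) || (i == ordS j))%:R.

(* [v] only labels the vertices by matrix indices, so that the order of the
   graph is [n.+1], the form of dimension required by [horner_mx]. *)
Definition cyclic_excess (T : finType) (e : rel T) (d g : nat) : Prop :=
  exists (n : nat) (v : 'I_n.+1 -> T) (B : 'M[int]_n.+1),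
    [/\ bijective v, cycle_mx B
      & horner_mx (adj_mx e v) (G d g./2) = const_mx 1 - B].

Definition cyclic_excess_graph (T : finType) (e : rel T) (d g : nat) : Prop :=
  [/\ symmetric e /\ irreflexive e,
      (3 <= d)%N /\ regular e d,
      [/\ odd g, (5 <= g)%N & has_girth e g]
    & cyclic_excess e d g].

(* Main.v *)
(* Row sums of G_3(A) = J - B give the order n = d^3 - d^2 + d + 3, a multiple
   of 3 exactly when d = 0 or 2 mod 3. Since A is regular it commutes with J,
   hence with B, so A preserves every eigenspace of B, over any field F. The
   mu-eigenvectors of an n-cycle are the n-periodic solutions of
   y_(i+1) = mu y_i - y_(i-1), a space of dimension at most 2; when mu != 2 it is
   killed by J, so that G_3(A) + mu vanishes on it. If it is nonzero, the cubic
   G_3 + mu must therefore be reducible over F, i.e. have a root there.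
   For F = Q and mu = -1 the recurrence has period 3, and a rational root is an
   integer a with 2a + 1 dividing 7, which leaves only d = 6 and d = 8. These two
   have n = 189 and n = 459, multiples of 9; over F_17 the recurrence with
   mu = -3 has period 9, but the cubic has no root for either d. *)

Require Import Defs.
From mathcomp Require Import all_boot all_order all_algebra all_fingroup.
From mathcomp Require Import zify ring.

Set Implicit Arguments.
Unset Strict Implicit.
Unset Printing Implicit Defensive.

Import Order.TTheory GRing.Theory Num.Theory.
Local Open Scope ring_scope.

(** * Invariant subspaces and irreducible polynomials *)

Lemma stablemx_irreducible_eq0 (F : fieldType) (m n : nat)
    (U : 'M[F]_(m, n.+1)) (A : 'M[F]_n.+1) (p : {poly F}) :
  irreducible_poly p -> ((\rank U).+1 < size p)%N -> stablemx U A ->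
  U *m horner_mx A p = 0 -> U = 0.
Proof.
(* The vectors w, wA, ..., wA^r with r = \rank U are linearly dependent, which
   yields q != 0 of degree at most r, hence coprime to p, with w q(A) = 0. *)
move=> irr_p rU sUA Up; apply/eqP; rewrite -nz_row_eq0; set w := nz_row U.
have wU : (w <= U)%MS by exact: nz_row_sub.
have wAU i : (w *m A ^+ i <= U)%MS.
  elim: i => [|i IHi]; first by rewrite expr0 mulmx1.
  by rewrite exprSr mulmxA; apply: submx_trans sUA; exact: submxMr.
pose K := \matrix_(i < (\rank U).+1) (w *m A ^+ i).
have kerK : kermx K != 0.
  rewrite kermx_eq0 /row_free neq_ltn ltnS mxrankS //.
  by apply/row_subP => i; rewrite rowK.
pose c := nz_row (kermx K).
have cK : c *m K = 0 by apply/sub_kermxP; exact: nz_row_sub.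
pose q := rVpoly c.
have q0 : q != 0.
  apply: contraNneq kerK => q0.
  by rewrite -nz_row_eq0 -/c -[c]rVpolyK -/q q0 linear0.
have wq : w *m horner_mx A q = 0.
  rewrite -cK /q horner_rVpoly [c *m K]mulmx_sum_row.
  rewrite [c *m powers_mx _ _]mulmx_sum_row linear_sum mulmx_sumr.
  by apply: eq_bigr => i _; rewrite linearZ /= !rowK mxvecK -scalemxAr.
have wp : w *m horner_mx A p = 0.
  by have /submxP[D ->] := wU; rewrite -mulmxA Up mulmx0.
have cop : coprimep p q.
  rewrite irreducible_poly_coprime //; apply/negP => /(dvdp_leq q0).
  by rewrite leqNgt (leq_ltn_trans (size_poly _ _)).
have /Bezout_eq1_coprimepP[[u v] /= uv] := cop.
rewrite -[w]mulmx1 -[1%:M](rmorph1 (horner_mx A)) -uv.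
rewrite mulrC [v * q]mulrC rmorphD !rmorphM /= mulmxDr.
by rewrite !mulmxA wp wq !mul0mx addr0.
Qed.

(** * Eigenspaces of an n-cycle *)

Definition cyclic_indexing (R : nzRingType) (n : nat) (s : 'S_n) (B : 'M[R]_n) :=
  forall i j, B (s i) (s j) = ((j == ordS i) || (i == ordS j))%:R.

Lemma ordS_neq_ord_pred n (i : 'I_n) : (3 <= n)%N -> ordS i != ord_pred i.
Proof.
move=> n3; apply/eqP => /(congr1 (@ordS n)); rewrite ord_predK.
move=> /(congr1 val) /=; rewrite -addn1 modnDml addn1.
have := ltn_ord i; have [i2n|ni2] := ltnP i.+2 n => lin.
  by rewrite modn_small //; lia.
by rewrite -(subnK ni2) modnDr modn_small; lia.
Qed.

Lemma sum_cyclic_indexing (R : nzRingType) n (s : 'S_n) (B : 'M[R]_n)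
    (w : 'rV_n) j :
  (3 <= n)%N -> cyclic_indexing s B ->
  (w *m B) 0 (s j) = w 0 (s (ord_pred j)) + w 0 (s (ordS j)).
Proof.
move=> n3 sB; rewrite mxE (reindex_inj (@perm_inj _ s)) /=.
rewrite (bigD1 (ord_pred j)) //= (bigD1 (ordS j)) /=; last first.
  by rewrite ordS_neq_ord_pred.
rewrite !sB ord_predK !eqxx orbT !mulr1 big1 ?addr0 // => i /andP[ip iS].
rewrite sB (negPf iS) orbF.
by case: (j =P ordS i) ip => [->|_ _]; rewrite ?ordSK ?eqxx ?mulr0.
Qed.

Lemma ordS_inZp n k : ordS (inZp k) = inZp k.+1 :> 'I_n.+1.
Proof. by apply: val_inj; rewrite /= -[(k %% _).+1]addn1 modnDml addn1. Qed.

(** By the recurrence, an eigenvector is determined by its entries at the cycle positions 0 and 1.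
    [P] reads off these two entries, so it is injective on the eigenspace. *)
Lemma rank_eigenspace_cycle (F : fieldType) n (s : 'S_n.+1) (B : 'M[F]_n.+1) mu :
  (3 <= n.+1)%N -> cyclic_indexing s B -> (\rank (eigenspace B mu) <= 2)%N.
Proof.
move=> n3 sB; set U := eigenspace B mu.
pose P : 'M[F]_(n.+1, 2) := \matrix_(i, j) (i == s (inZp j))%:R.
suff /eqP/(mxrank_injP 2) <- : (U :&: kermx P)%MS = 0 by exact: rank_leq_col.
apply/eqP; rewrite -nz_row_eq0; set w := nz_row _.
have /andP[/eigenspaceP wB /sub_kermxP wP] : (w <= U)%MS && (w <= kermx P)%MS.
  by rewrite -sub_capmx nz_row_sub.
have w01 (k : 'I_2) : w 0 (s (inZp k)) = 0.
  move/matrixP/(_ 0 k): wP; rewrite !mxE (bigD1 (s (inZp k))) //= !mxE eqxx.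
  by rewrite mulr1 big1 ?addr0 // => i ik; rewrite mxE (negPf ik) mulr0.
have w0 k : w 0 (s (inZp k)) = 0 /\ w 0 (s (inZp k.+1)) = 0.
  elim: k => [|k [IH0 IH1]]; first by split; [apply: (w01 0)|apply: (w01 1)].
  split=> //; move/matrixP/(_ 0 (s (inZp k.+1))): wB.
  rewrite (sum_cyclic_indexing _ _ n3 sB) mxE IH1 mulr0.
  by rewrite -ordS_inZp ordSK IH0 add0r !ordS_inZp.
apply/eqP/rowP => i; rewrite mxE -[i](permKV s) -[X in s X]valZpK.
by have [] := w0 (val ((s^-1)%g i)).
Qed.

Section Recurrence.
Variables (F : fieldType) (mu : F).

(** The state is a pair of consecutive terms, so periodicity amounts to the return of the initial
    state, a finite computation for concrete [mu]. *)
Definition recurrence_step (z : F * F) : F * F := (z.2, mu * z.2 - z.1).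

Definition recurrence_seq (i : nat) : F := (iter i recurrence_step (0, 1)).1.

Lemma recurrence_seqSS i :
  recurrence_seq i + recurrence_seq i.+2 = mu * recurrence_seq i.+1.
Proof. by rewrite /recurrence_seq /=; ring. Qed.

Lemma recurrence_seq_modn k n i :
  iter k recurrence_step (0, 1) = (0, 1) -> (k %| n)%N ->
  recurrence_seq (i %% n) = recurrence_seq i.
Proof.
move=> kP /dvdnP[m ->].
have iterM l : iter (l * k) recurrence_step (0, 1) = (0, 1).
  by elim: l => // l IHl; rewrite mulSn iterD IHl.
by rewrite [in RHS](divn_eq i (m * k)) mulnA addnC /recurrence_seq iterD iterM.
Qed.

End Recurrence.

(** The sequence starting 0, 1, written along the cycle, closes up because its period divides the
    order; its entry at position 1 is nonzero. *)
Lemma eigenspace_cycle_neq0 (F : fieldType) n k (s : 'S_n.+1) (B : 'M[F]_n.+1) mu :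
  (3 <= n.+1)%N -> cyclic_indexing s B -> (k %| n.+1)%N ->
  iter k (recurrence_step mu) (0, 1) = (0, 1) -> eigenspace B mu != 0.
Proof.
move=> n3 sB kn kP; pose a := recurrence_seq mu.
have aE i : a (i %% n.+1)%N = a i := recurrence_seq_modn i kP kn.
pose w : 'rV[F]_n.+1 := \row_i a ((s^-1)%g i).
have wE j : w 0 (s j) = a j by rewrite mxE permK.
have : (w <= eigenspace B mu)%MS.
  apply/eigenspaceP/rowP => i; rewrite -[i](permKV s); move: ((s^-1)%g i) => j.
  rewrite (sum_cyclic_indexing _ _ n3 sB) [RHS]mxE !wE /= !aE.
  (* Shifting by a full turn keeps the predecessor index [j + n] nonnegative, also for [j = 0]. *)
  have aS i' : a (i' + n.+1)%N = a i' by rewrite -aE modnDr aE.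
  rewrite -[a j]aS -[a j.+1]aS addnS /= addSn addnS.
  exact: recurrence_seqSS.
apply: contraTneq => ->; rewrite submx0; apply/eqP => /rowP/(_ (s (inZp 1))).
by rewrite wE mxE /= aE /a /recurrence_seq /=; apply/eqP; rewrite oner_eq0.
Qed.

Lemma const_mx_mul_cycle (R : nzRingType) n (s : 'S_n) (B : 'M[R]_n) m :
  (3 <= n)%N -> cyclic_indexing s B ->
  const_mx 1 *m B = const_mx 2 :> 'M_(m, n).
Proof.
move=> n3 sB; apply/row_matrixP => k; rewrite row_mul !row_const.
apply/rowP => i; rewrite -[i](permKV s) (sum_cyclic_indexing _ _ n3 sB).
by rewrite !mxE.
Qed.

Lemma cyclic_indexing_tr (R : nzRingType) n (s : 'S_n) (B : 'M[R]_n) :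
  cyclic_indexing s B -> B^T = B.
Proof.
move=> sB; apply/matrixP => i j; rewrite mxE -[i](permKV s) -[j](permKV s).
by rewrite !sB orbC.
Qed.

(** With J the all-ones matrix, UBJ equals both [mu] UJ and 2UJ. *)
Lemma eigenspace_cycle_mul_const (F : fieldType) n (s : 'S_n) (B : 'M[F]_n) mu m :
  (3 <= n)%N -> cyclic_indexing s B -> mu != 2 ->
  eigenspace B mu *m const_mx 1 = 0 :> 'M_(n, m).
Proof.
move=> n3 sB mu2; set U := eigenspace B mu.
have UB : U *m B = mu *: U by apply/eigenspaceP.
have BJ : B *m const_mx 1 = 2 *: const_mx 1 :> 'M_(n, m).
  rewrite -(cyclic_indexing_tr sB) -[const_mx 1]trmxK trmx_const -trmx_mul.
  rewrite (const_mx_mul_cycle _ n3 sB).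
  by apply/matrixP => i j; rewrite !mxE mulr1.
apply/eqP; have := congr1 (mulmx^~ (const_mx 1 : 'M_(n, m))) UB.
rewrite /= -mulmxA BJ -scalemxAl -scalemxAr => /eqP.
by rewrite eq_sym -subr_eq0 -scalerBl scaler_eq0 subr_eq0 (negPf mu2).
Qed.

(** * The cubic and its reducibility *)

Lemma G3E d : G d 3 = 'X^3 + ('X^2 - (2 * (d%:R - 1)) *: 'X - (d%:R - 1)%:P).
Proof.
rewrite /=; set c := d%:R - 1.
by rewrite -!mul_polyC polyCM (rmorph_nat polyC); ring.
Qed.

Definition excess_cubic (F : fieldType) (d : nat) (mu : F) : {poly F} :=
  map_poly intr (G d 3) + mu%:P.

Lemma excess_cubicE (F : fieldType) d (mu : F) :
  excess_cubic d mu
    = 'X^3 + ('X^2 - (2 * (d%:R - 1)) *: 'X + (mu - (d%:R - 1))%:P).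
Proof.
rewrite /excess_cubic G3E; set c : int := d%:R - 1.
have <- : c%:~R = d%:R - 1 :> F by rewrite rmorphB rmorph_nat.
rewrite (rmorphD (map_poly _)) !(rmorphB (map_poly _)) /= map_polyZ /= map_polyC.
by rewrite !map_polyXn map_polyX /= rmorphM rmorph_nat polyCB; ring.
Qed.

Lemma size_excess_cubic (F : fieldType) d (mu : F) : size (excess_cubic d mu) = 4.
Proof.
rewrite excess_cubicE size_polyDl size_polyXn //.
rewrite -scaleNr; apply: leq_ltn_trans (size_polyD _ _) _; rewrite gtn_max.
rewrite (leq_ltn_trans (size_polyC_leq1 _)) // andbT.
apply: leq_ltn_trans (size_polyD _ _) _; rewrite gtn_max size_polyXn /=.
by apply: leq_ltn_trans (size_scale_leq _ _) _; rewrite size_polyX.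
Qed.

Lemma horner_excess_cubic (F : fieldType) d (mu x : F) :
  (excess_cubic d mu).[x] = x ^+ 3 + x ^+ 2 - 2 * (d%:R - 1) * x - (d%:R - 1) + mu.
Proof.
by rewrite excess_cubicE; move: (d%:R - 1) => c; rewrite !hornerE /=; ring.
Qed.

Section CyclicExcess.
Variables (n d : nat) (A B : 'M[int]_n.+1) (s : 'S_n.+1).
Hypotheses (n_ge3 : (3 <= n.+1)%N) (sB : cyclic_indexing s B).
Hypothesis A_tr : A^T = A.
Hypothesis A_regular : forall m,
  const_mx 1 *m A = d%:R *: const_mx 1 :> 'M_(m, n.+1).
Hypothesis GA : horner_mx A (G d 3) = const_mx 1 - B.

Lemma excess_comm : comm_mx A B.
Proof.
have AJ : A *m const_mx 1 = d%:R *: const_mx 1 :> 'M_n.+1.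
  by rewrite -A_tr -[const_mx 1]trmxK trmx_const -trmx_mul A_regular linearZ.
have : comm_mx A (horner_mx A (G d 3)) by apply: comm_mx_horner.
rewrite GA /comm_mx mulmxBr mulmxBl AJ A_regular => /addrI/oppr_inj.
by [].
Qed.

Lemma excess_order : n.+1%:R = d%:R ^+ 3 - d%:R ^+ 2 + d%:R + 3 :> int.
Proof.
pose u : 'rV[int]_n.+1 := const_mx 1.
have uA : u *m A = d%:R *: u by exact: A_regular.
have uA2 : u *m (A * A) = d%:R ^+ 2 *: u.
  by rewrite mulmxA uA -scalemxAl uA scalerA.
have uA3 : u *m (A * A * A) = d%:R ^+ 3 *: u.
  by rewrite mulmxA uA2 -scalemxAl uA scalerA -exprSr.
(* [u] is an eigenvector of both sides: the left gives G_3(d) = d^3 - d^2 + d + 1, the right gives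
   the order minus 2. *)
have := congr1 (mulmx u) GA.
rewrite G3E (rmorphD (horner_mx A)) !(rmorphB (horner_mx A)) /= linearZ /= !rmorphXn /=.
rewrite horner_mx_X horner_mx_C !exprS expr0 mulr1 mulrA !(mulmxBr, mulmxDr).
rewrite uA3 uA2 -scalemxAr uA mul_mx_scalar scalerA.
rewrite mulmxN (const_mx_mul_cycle _ n_ge3 sB) => /rowP/(_ 0); rewrite !mxE.
rewrite (eq_bigr (fun=> 1)) => [|i _]; last by rewrite !mxE mulr1.
rewrite sumr_const card_ord => H.
by apply/eqP; rewrite -subr_eq0 -[X in X - _](subrK 2) -H; apply/eqP; ring.
Qed.

Lemma excess_cubic_reducible (F : fieldType) (mu : F) k :
  mu != 2 -> (k %| n.+1)%N -> iter k (recurrence_step mu) (0, 1) = (0, 1) ->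
  ~ forall x, (excess_cubic d mu).[x] != 0.
Proof.
move=> mu2 kn kP noroot.
have sBF : cyclic_indexing s (map_mx intr B : 'M[F]_n.+1).
  by move=> i j; rewrite mxE sB rmorph_nat.
set U := eigenspace (map_mx intr B) mu.
have /eqP[] := eigenspace_cycle_neq0 n_ge3 sBF kn kP.
apply: (@stablemx_irreducible_eq0 _ _ _ _ (map_mx intr A) (excess_cubic d mu)).
- by apply: cubic_irreducible; rewrite ?size_excess_cubic.
- by rewrite size_excess_cubic !ltnS (rank_eigenspace_cycle _ n_ge3 sBF).
- apply: comm_mx_stable_eigenspace.
  by rewrite /comm_mx -!map_mxM excess_comm.
rewrite rmorphD /= -map_horner_mx GA map_mxB map_const_mx /= mulr1z horner_mx_C.
rewrite mulmxDr mulmxBr (eigenspace_cycle_mul_const _ n_ge3 sBF mu2) sub0r.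
have /eigenspaceP -> := submx_refl U.
by rewrite mul_mx_scalar addNr.
Qed.

End CyclicExcess.

(** * Excluding roots over the rationals and over F_17 *)

Lemma rat_root_monic_cubic (b c e : int) (x : rat) :
  x ^+ 3 + b%:~R * x ^+ 2 + c%:~R * x + e%:~R = 0 -> exists a : int, x = a%:~R.
Proof.
move=> x_root; set p := numq x; set q := denq x.
have q0 : q%:~R != 0 :> rat by rewrite intr_eq0 denq_neq0.
have xE : x = p%:~R / q%:~R by rewrite divq_num_den.
have E : p ^+ 3 = - q * (b * p ^+ 2 + c * p * q + e * q ^+ 2).
  apply/eqP; rewrite -(eqr_int rat); apply/eqP.
  rewrite !(rmorphM, rmorphN, rmorphD, rmorphXn) /=.
  move: x_root; rewrite xE => /(congr1 ( *%R (q%:~R ^+ 3))).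
  rewrite mulr0 => x_root; apply/eqP; rewrite -subr_eq0 -x_root; apply/eqP.
  by field.
have qp3 : (q %| p ^+ 3 * 1)%Z.
  rewrite mulr1; apply/dvdzP; exists (- (b * p ^+ 2 + c * p * q + e * q ^+ 2)).
  by rewrite E; ring.
have cop : coprimez q (p ^+ 3).
  by rewrite coprimez_sym coprimezXl // coprimezE coprime_num_den.
have q1 : q = 1.
  by move: qp3; rewrite Gauss_dvdzr // dvdz1; have := denq_gt0 x; rewrite -/q; lia.
by exists p; rewrite xE q1 divr1.
Qed.

Lemma int_root_excess_cubic (d : nat) (a : int) :
  a ^+ 3 + a ^+ 2 - 2 * (d%:R - 1) * a - d%:R = 0 -> (3 <= d)%N ->
  d \in [:: 6; 8]%N.
Proof.
move=> a_root d3.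
have dv7 : (2 * a + 1 %| 7)%Z.
  (* Dividing 8 times the cubic by 2a + 1 leaves this quotient and remainder -7. *)
  apply/dvdzP; exists (4 * a ^+ 2 + 2 * a + 7 - 8 * d%:R).
  apply/eqP; rewrite -subr_eq0 -[X in _ == X](mulr0 (- 8)) -a_root.
  by apply/eqP; ring.
have a_le : (absz (2 * a + 1)%R <= 7)%N.
  by apply: (@dvdn_leq _ 7) => //; rewrite dvdzE in dv7.
have : a \in [:: -4; -3; -2; -1; 0; 1; 2; 3] by rewrite !inE; lia.
rewrite !inE => a_small; move: a_small a_root.
(* The value -4 gives d = 8 and the value 3 gives d = 6; every other one gives d < 3 or a
   non-integral d. *)
do 7! (case/orP=> [/eqP->|]; first by lia).
by move/eqP->; lia.
Qed.

(** Here -3 is z + 1/z for a primitive ninth root of unity z in F_289, since (-3)^3 - 3(-3) = -1 mod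
    17; hence the period 9. The absence of roots is checked on all 17 elements. *)
Lemma no_root_F17 (d : nat) (x : 'F_17) :
  d \in [:: 6; 8]%N -> (excess_cubic d (- 3 : 'F_17)).[x] != 0.
Proof.
move=> d68; rewrite horner_excess_cubic.
by move: d68; rewrite !inE => /orP[]/eqP->; case: x; do 17! case=> //.
Qed.

Local Close Scope ring_scope.

Theorem theorem5 (T : finType) (e : rel T) (d : nat)
  (d_ge3 : 3 <= d) (d_mod3 : d = 0 %[mod 3] \/ d = 2 %[mod 3]) :
  ~ cyclic_excess_graph e d 7.
Proof.
move=> [[e_sym _] [_ e_reg] _ [n [v [B [v_bij [n3 [s sB]] GA]]]]].
have A_tr : ((adj_mx e v)^T = adj_mx e v)%R.
  by apply/matrixP => i j; rewrite !mxE e_sym.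
have A_reg m : (const_mx 1 *m adj_mx e v = d%:R *: const_mx 1 :> 'M_(m, n.+1))%R.
  apply/matrixP => i j; rewrite !mxE mulr1 -(e_reg (v j)) -sum1_card natr_sum.
  rewrite [RHS]big_mkcond [RHS](reindex v) /=; last by apply: onW_bij.
  apply: eq_bigr => k _; rewrite !mxE mul1r e_sym inE.
  by case: (e _ _).
have n_eq := excess_order n3 sB A_reg GA.
have no_root := excess_cubic_reducible n3 sB A_tr A_reg GA.
have [d68|d68] := boolP (d \in [:: 6; 8]%N).
  apply: (no_root _ (- 3 : 'F_17)%R 9) => // [||x]; last exact: no_root_F17.
  by move: d68 n_eq; rewrite !inE => /orP[]/eqP->; lia.
  by apply/eqP.
(* For [mu] = -1 the sequence is 0, 1, -1, 0, 1, ..., and the constant term of the cubic becomes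
   -d. *)
apply: (no_root rat (- 1)%R 3) => // [|x]; first by lia.
apply: contraNneq d68; rewrite horner_excess_cubic => x_root.
have [|a xE] := @rat_root_monic_cubic 1 (- (2 * (d%:R - 1))) (- d%:R) x.
  rewrite -x_root !(rmorphM, rmorphN, rmorphB) /= !rmorph_nat; ring.
apply: (@int_root_excess_cubic _ a) => //.
apply/eqP; rewrite -(intr_eq0 rat) -x_root xE; apply/eqP.
by rewrite !(rmorphM, rmorphN, rmorphD, rmorphXn) /= !rmorph_nat; ring.
Qed.
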